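(* Let $\langle Y, \tau_Y\rangle$ be a submetrizable, collectionwise normal and perfect topological space, let $\langle X, \tau_X\rangle$ be a submetrizable topological space, and let $f\colon \langle X, \tau_X\rangle \to \langle Y, \tau_Y\rangle$ be a perfect map. Then the triple $\langle f, \langle X, \tau_X\rangle, \langle Y, \tau_Y\rangle\rangle$ is (perfect)-submetrizable; that is, there exist topologies $\sigma_X \subseteq \tau_X$ on $X$ and $\sigma_Y \subseteq \tau_Y$ on $Y$ such that $\langle X, \sigma_X\rangle$ and $\langle Y, \sigma_Y\rangle$ are metrizable and $f\colon \langle X, \sigma_X\rangle \to \langle Y, \sigma_Y\rangle$ is a perfect map.
   Context: A topological space $\langle X,\tau\rangle$ is submetrizable if there is a topology $\sigma\subseteq\tau$ on $X$ such that $\langle X,\sigma\rangle$ is metrizable. A space is perfect if every closed subset is a $G_\delta$ set. A map between topological spaces is perfect if it is continuous, closed, and all its point preimages (fibers) are compact; surjectivity is not part of the definition. If $\langle X,\tau_X\rangle$ and $\langle Y,\tau_Y\rangle$ are submetrizable and $f\colon\langle X,\tau_X\rangle\to\langle Y,\tau_Y\rangle$ is perfect, the triple $\langle f,\langle X,\tau_X\rangle,\langle Y,\tau_Y\rangle\rangle$ is called (perfect)-submetrizable if there exist metrizable topologies $\sigma_X\subseteq\tau_X$ on $X$ and $\sigma_Y\subseteq\tau_Y$ on $Y$ such that $f\colon\langle X,\sigma_X\rangle\to\langle Y,\sigma_Y\rangle$ is perfect. *)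

(* Defs.v *)
From HB Require Import structures.
From mathcomp Require Import all_boot all_order all_algebra.
From mathcomp Require Import all_classical all_reals.
From mathcomp Require Import topology borel_hierarchy.

Set Implicit Arguments.
Unset Strict Implicit.
Unset Printing Implicit Defensive.

Local Open Scope classical_set_scope.

(* An alternative topology on a type [T] is a term of the class
   [Topological.axioms_ T]; [retopologize s] is [T] endowed with it.  Only the
   carrier of a given space is shared: the canonical topology of [T], if any,
   plays no role in [retopologize s]. *)
Definition retopologize (T : Type) (s : Topological.axioms_ T) :
  topologicalType := Topological.Pack s.

Definition coarser (X : topologicalType) (s : Topological.axioms_ X) : Prop :=
  @open (retopologize s) `<=` @open X.

(* All [realType]s are isomorphic, so the choice of [R] is immaterial. *)
Definition metrizable (R : realType) (T : topologicalType) : Prop :=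
  exists m : Metric.axioms_ R T, @open (Metric.Pack m) = @open T.

Definition submetrizable (R : realType) (X : topologicalType) : Prop :=
  exists2 s : Topological.axioms_ X, coarser s & metrizable R (retopologize s).

(* Unrelated to [perfect_set], which is about isolated points. *)
Definition perfect_space (T : topologicalType) : Prop :=
  forall A : set T, closed A -> Gdelta A.

Definition discrete_family (T : topologicalType) (I : Type) (F : I -> set T) :
    Prop :=
  forall x : T, exists2 V : set T, nbhs x V &
    forall i j : I, F i `&` V !=set0 -> F j `&` V !=set0 -> i = j.

(* No separation axiom is built in; a submetrizable space is Hausdorff anyway.
   In the presence of normality (the case of two closed sets), asking the
   family [U] to be discrete instead of disjoint gives an equivalent notion. *)
Definition collectionwise_normal (T : topologicalType) : Prop :=
  forall (I : Type) (F : I -> set T),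
    (forall i, closed (F i)) -> discrete_family F ->
    exists U : I -> set T,
      [/\ forall i, open (U i), forall i, F i `<=` U i & trivIset setT U].

(* A perfect map need not be surjective. *)
Definition perfect_map (X Y : topologicalType) (f : X -> Y) : Prop :=
  [/\ continuous f,
      forall C : set X, closed C -> closed (f @` C) &
      forall y : Y, compact (f @^-1` [set y])].

Definition perfect_submetrizable (R : realType) (X Y : topologicalType)
    (f : X -> Y) : Prop :=
  exists (sX : Topological.axioms_ X) (sY : Topological.axioms_ Y),
    [/\ coarser sX, coarser sY,
        metrizable R (retopologize sX), metrizable R (retopologize sY) &
        @perfect_map (retopologize sX) (retopologize sY) f].

(* Main.v *)
Require Import Defs.
From mathcomp Require Import finmap.
From mathcomp Require Import all_boot all_order all_algebra.
From mathcomp Require Import all_classical all_reals.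
From mathcomp Require Import topology.
From HB Require Import structures.
From mathcomp Require Import lra.
From mathcomp Require Import interval_inference normedtype.
From mathcomp Require wochoice.

Set Implicit Arguments.
Unset Strict Implicit.
Unset Printing Implicit Defensive.

Import Order.TTheory GRing.Theory Num.Theory.
Import numFieldNormedType.Exports.

Local Open Scope classical_set_scope.
Local Open Scope ring_scope.

(** A continuous metric [dX] on [X] and a continuous metric [dY] on [Y] exist by
    submetrizability.  Given any continuous metric [D] on [Y], the distance
    [max (dX x x') (D (f x) (f x'))] is a continuous metric on [X] for which [f]
    is continuous with compact fibres.  Closedness of [f] for these two metrics
    amounts to upper semicontinuity of [y |-> f^-1(y)] from [(Y, D)] to
    [(X, dX)]: for each [e > 0], the fibres over a small [D]-ball at [y] lie in
    the [e]-neighbourhood of the fibre over [y] ([perfect_map_distance]).  The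
    whole problem is to choose [D] fine enough for this.

    Fix [e].  Like every metric space, [(X, dX)] has a locally finite closed
    cover [C] by sets of diameter less than [e] ([small_closed_cover]).  As [f]
    is perfect, the closed sets [f(C i)] form a locally finite family in [Y]
    ([perfect_map_locally_finite]).  Suppose that a neighbourhood [V] of [y]
    meets only those [f(C i)] that contain [y].  A point [x'] over [V] lies in
    some [C i], hence [y] is in [f(C i)], and [C i] has a point over [y], which
    is [e]-close to [x'].  So [D] only has to make all such [V]
    neighbourhoods of their points, and countably many values of [e] suffice.

    For a locally finite closed family [K] in [Y], let [S y] be the set of the
    indices [i] with [K i y].  Near [y] one has [S y' <= S y], so
    [{y | #|S y| = m}] is the intersection of an open and a closed set, and as
    [Y] is perfect it is a countable union of closed sets [E].  On such an [E]
    the map [S] is locally constant, so the pieces of [E] on which [S] has a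
    given value form a discrete closed family, and collectionwise normality
    separates it by disjoint open sets.  Urysohn functions turn this separation
    into one continuous pseudometric per [E] ([discrete_family_separation],
    [locally_finite_resolution]).  In all, countably many pseudometrics occur,
    and a weighted supremum merges them with [dY] into the single metric [D]
    ([combine_pseudometrics]). *)

(** * Continuous pseudometrics and coarser metrizable topologies *)

Definition pseudometric (R : realType) (T : Type) (d : T -> T -> R) : Prop :=
  [/\ forall x, d x x = 0, forall x y, d x y = d y x &
      forall y x z, d x z <= d x y + d y z].

Definition separating (R : realType) (T : Type) (d : T -> T -> R) : Prop :=
  forall x y, d x y = 0 -> x = y.

(** For a pseudometric, this is joint continuity: by the triangle inequality it
    suffices that each point has its balls as neighbourhoods. *)
Definition continuous_distance (R : realType) (T : topologicalType)
    (d : T -> T -> R) : Prop :=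
  forall x e, 0 < e -> \forall y \near x, d x y < e.

Lemma pseudometric_ge0 (R : realType) (T : Type) (d : T -> T -> R) x y :
  pseudometric d -> 0 <= d x y.
Proof.
by case=> d0 dsym dtri; have := dtri y x x; rewrite d0 (dsym y x); lra.
Qed.

Lemma submetrizable_distance (R : realType) (T : topologicalType) :
  submetrizable R T ->
  exists d : T -> T -> R,
    [/\ pseudometric d, separating d & continuous_distance d].
Proof.
case=> s st [m mE]; pose M : metricType R := Metric.Pack m.
exists (@mdist R M); split; first split.
- exact: (@mdistxx R M).
- exact: (@metric_sym R M).
- by move=> y x z; exact: (@metric_triangle R M).
- exact: (@mdist_positivity R M).
move=> x e e0; have := @nbhsx_ballx R M x e e0.
rewrite nbhsE ballEmdist => -[U [oU Ux] Ub].
apply: (@filterS _ (nbhs (x : T)) _ U _ Ub).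
by apply: open_nbhs_nbhs; split => //; have := st U; rewrite -mE; apply.
Qed.

(** An alias of the carrier, to which the topology of the metric can be attached
    without clashing with the given topology. *)
Definition with_distance (R : realType) (T : topologicalType)
  (d : T -> T -> R) : Type := T.

Section with_distance.
Variables (R : realType) (T : topologicalType) (d : T -> T -> R).
Hypotheses (d_pm : pseudometric d) (d_sep : separating d).

Let dxx x : d x x = 0. Proof. by case: d_pm. Qed.
Let dsym x y : d x y = d y x. Proof. by case: d_pm. Qed.
Let dtri y x z : d x z <= d x y + d y z. Proof. by case: d_pm. Qed.

HB.instance Definition _ := Choice.copy (with_distance d) T.
HB.instance Definition _ :=
  @isMetric.Build R (with_distance d) d dxx d_sep dsym dtri.

Lemma distance_topology :
  exists s : Topological.axioms_ T, metrizable R (retopologize s) /\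
    forall x A, @nbhs _ (retopologize s) x A <->
      exists2 e, 0 < e & forall y, d x y < e -> A y.
Proof.
exists (Topological.class (with_distance d)); split.
  by exists (Metric.class (with_distance d)).
by move=> x A; apply: (@nbhs_ballP R (with_distance d) x A).
Qed.

End with_distance.

Lemma continuous_distance_coarser (R : realType) (T : topologicalType)
    (d : T -> T -> R) (s : Topological.axioms_ T) :
  continuous_distance d ->
  (forall x A, @nbhs _ (retopologize s) x A ->
     exists2 e, 0 < e & forall y, d x y < e -> A y) ->
  coarser s.
Proof.
move=> d_dom sE A; rewrite !openE => oA x /oA /sE[e e0 eA].
exact: filterS (d_dom x e e0).
Qed.

(** The supremum of the truncations [min (w j) (rho j)], with weights [w j] that
    tend to [0], is continuous since near a given point all but finitely many
    of the truncations are uniformly small, and it bounds each [rho j] where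
    it is less than [w j]. *)
Lemma combine_pseudometrics (R : realType) (T : topologicalType)
    (J : countType) (rho : J -> T -> T -> R) :
  (forall j, pseudometric (rho j)) -> (forall j, continuous_distance (rho j)) ->
  exists D : T -> T -> R, [/\ pseudometric D, continuous_distance D &
    forall j e, 0 < e ->
      exists2 r, 0 < r & forall x y, D x y < r -> rho j x y < e].
Proof.
move=> rho_pm rho_dom.
pose w (j : J) : R := (pickle j).+1%:R^-1.
have w0 j : 0 < w j by rewrite invr_gt0 ltr0n.
have w1 j : w j <= 1 by rewrite invf_le1 ?ltr0n// ler1n.
have rho0 j x y : 0 <= rho j x y by apply: pseudometric_ge0.
pose t j x y := Num.min (w j) (rho j x y).
have tE j x y : t j x y = Num.min (w j) (rho j x y) by [].
(* The point [0] keeps the set nonempty when [J] is empty. *)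
pose S x y : set R := 0 |` [set t j x y | j in [set: J]].
have S0 x y : S x y !=set0 by exists 0; left.
have Sub x y : has_ubound (S x y).
  by exists 1 => _ [->//|[j _ <-]]; rewrite tE ge_min w1.
pose D x y := sup (S x y).
have D0 x y : 0 <= D x y by apply: ub_le_sup => //; left.
have tD j x y : t j x y <= D x y by apply: ub_le_sup => //; right; exists j.
have Dle x y c : 0 <= c -> (forall j, t j x y <= c) -> D x y <= c.
  by move=> c0 tc; apply: ge_sup => // _ [->//|[j _ <-]].
exists D; split; first split.
- move=> x; apply/eqP; rewrite eq_le D0 andbT; apply: Dle => // j.
  by have [d0 _ _] := rho_pm j; rewrite tE d0 ge_min lexx orbT.
- move=> x y; rewrite /D; congr (sup (_ |` _)); apply: eq_imagel => j _.
  by have [_ dsym _] := rho_pm j; rewrite tE dsym.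
- move=> y x z; apply: Dle; first by rewrite addr_ge0.
  move=> j; apply: (@le_trans _ _ (t j x y + t j y z)); last exact: lerD.
  have [_ _ /(_ y x z)] := rho_pm j; rewrite !tE.
  have := rho0 j x y; have := rho0 j y z; have := w0 j.
  by rewrite /Num.min; do 3! case: ifP; lra.
- move=> x e e0; have e20 : 0 < e / 2 by rewrite divr_gt0.
  have [N _ /(_ _ (leqnn N)) NE] := near_infty_natSinv_lt (PosNum e20).
  have near_small : \forall y \near x, forall n : 'I_N.+1, forall j,
      pickle j = n -> rho j x y < e / 2.
    apply: filter_forall => n; case jE : (unpickle n : option J) => [j0|].
      apply: filterS (rho_dom j0 x _ e20) => y jy j jn.
      by move: jE; rewrite -jn pickleK => -[->].
    by apply: nearW => y j jn; move: jE; rewrite -jn pickleK.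
  apply: filterS near_small => y small_y.
  apply: (@le_lt_trans _ _ (e / 2)); last lra.
  apply: Dle => [|j]; first exact: ltW.
  rewrite tE ge_min; have [jN|Nj] := ltnP (pickle j) N.+1.
    by rewrite (ltW (small_y (Ordinal jN) j erefl)) orbT.
  apply/orP; left; apply: (le_trans _ (ltW NE)).
  by rewrite lef_pV2 ?posrE ?ltr0n// ler_nat (leqW Nj).
- move=> j e e0; exists (Num.min (w j) e); first by rewrite lt_min w0 e0.
  move=> x y; rewrite lt_min => /andP[Dw De].
  have := le_lt_trans (tD j x y) Dw; have := le_lt_trans (tD j x y) De.
  by rewrite tE !gt_min ltxx/= => /orP[we rw|//]; exact: lt_trans rw we.
Qed.

(** * Locally finite families and collectionwise normality *)

Definition locally_finite (T : topologicalType) (I : Type) (F : I -> set T) :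
    Prop :=
  forall x : T, exists2 V : set T, nbhs x V &
    finite_set [set i | F i `&` V !=set0].

Lemma locally_finite_bigcup_closed (T : topologicalType) (I : choiceType)
    (F : I -> set T) (D : set I) :
  (forall i, closed (F i)) -> locally_finite F -> closed (\bigcup_(i in D) F i).
Proof.
move=> Fcl Flf; rewrite -openC openE => x nFx.
have [V Vx finV] := Flf x.
pose A := D `&` [set i | F i `&` V !=set0].
have clA : closed (\bigcup_(i in A) F i).
  by apply: closed_bigcup => //; exact: finite_setIr.
have xA : nbhs x (~` \bigcup_(i in A) F i).
  apply: open_nbhs_nbhs; split; first exact: closed_openC.
  by move=> [i [Di _] Fix]; apply: nFx; exists i.
apply: filterS (filterI Vx xA) => z [Vz nAz] [i Di Fiz].
by apply: nAz; exists i => //; split => //; exists z.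
Qed.

(** The members that avoid [x] have a closed union, hence all avoid a common
    neighbourhood of [x]. *)
Lemma locally_finite_near (T : topologicalType) (I : choiceType)
    (F : I -> set T) :
  (forall i, closed (F i)) -> locally_finite F ->
  forall x, \forall y \near x, forall i, F i y -> F i x.
Proof.
move=> Fcl Flf x.
have : nbhs x (~` \bigcup_(i in [set i | ~ F i x]) F i).
  apply: open_nbhs_nbhs; split; last by move=> [i /= ].
  exact/closed_openC/locally_finite_bigcup_closed.
apply: filterS => y nFy i Fiy; apply: contrapT => nFix.
by apply: nFy; exists i.
Qed.

Lemma locally_finite_index (T : topologicalType) (I : Type) (F : I -> set T) x :
  locally_finite F -> finite_set [set i | F i x].
Proof.
move=> /(_ x)[V Vx]; apply: sub_finite_set => i Fix.
by exists x; split => //; exact: nbhs_singleton.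
Qed.

Lemma discrete_family_locally_finite (T : topologicalType) (I : Type)
    (F : I -> set T) : discrete_family F -> locally_finite F.
Proof.
move=> Fd x; have [V Vx FV] := Fd x; exists V => //.
have [->|/set0P[i Fi]] := eqVneq [set i | F i `&` V !=set0] set0.
  exact: finite_set0.
apply: (@sub_finite_set _ _ [set i]); last exact: finite_set1.
by move=> j /= Fj; apply: FV.
Qed.

Lemma collectionwise_normal_normal (R : realType) (T : topologicalType) :
  collectionwise_normal T -> normal_space T.
Proof.
move=> Tcwn; apply/(@normal_openP R) => A B Acl Bcl AB0.
pose F (b : bool) := if b then A else B.
have Fcl b : closed (F b) by case: b.
have Fd : discrete_family F.
  move=> x; have [Ax|nAx] := pselect (A x).
    exists (~` B).
      apply: open_nbhs_nbhs; split; first exact: closed_openC.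
      by move=> Bx; have : (A `&` B) x by []; rewrite AB0.
    by rewrite /F => -[] [] //= [y [Fy Vy]] [z [Fz Vz]].
  exists (~` A).
    by apply: open_nbhs_nbhs; split => //; exact: closed_openC.
  by rewrite /F => -[] [] //= [y [Fy Vy]] [z [Fz Vz]].
have [U [Uo FU Udisj]] := Tcwn bool F Fcl Fd.
exists (U true), (U false); split => //.
- exact: (FU true).
- exact: (FU false).
apply/eqP/negPn/negP => /set0P[y [Uty Ufy]].
by have : true = false by apply: Udisj => //; exists y.
Qed.

(** After shrinking, disjoint open [V i] lie between [E i] and [U i].  Let [h]
    be a Urysohn function equal to [1] on the union of the [E i] and to [0] off
    the union of the [V i].  Consider a hedgehog with spines indexed by [I], and
    map [V i] into the spine [i], at distance [h] from the centre, and all other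
    points to the centre: [rho] is the pullback of the hedgehog metric.  The
    points of [E i] go to the tip of the spine [i], and the ball of radius [1]
    at a tip stays within its spine. *)
Lemma discrete_family_separation (R : realType) (T : topologicalType)
    (I : choiceType) (E U : I -> set T) :
  collectionwise_normal T ->
  (forall i, closed (E i)) -> discrete_family E ->
  (forall i, open (U i)) -> (forall i, E i `<=` U i) ->
  exists rho : T -> T -> R, [/\ pseudometric rho, continuous_distance rho &
    forall i x y, E i x -> rho x y < 1 -> U i y].
Proof.
move=> Tcwn Ecl Ed Uo EU.
have [V0 [V0o EV0 V0disj]] := Tcwn I E Ecl Ed.
pose V i := V0 i `&` U i.
have Vo i : open (V i) by exact: openI.
have EV i : E i `<=` V i by move=> x Ex; split; [exact: EV0|exact: EU].
have Vdisj i j x : V i x -> V j x -> i = j.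
  by move=> [Vi _] [Vj _]; apply: V0disj => //; exists x.
pose A := ~` \bigcup_i V i; pose B := \bigcup_i E i.
have Acl : closed A by apply: open_closedC; exact: bigcup_open.
have Bcl : closed B.
  by apply: locally_finite_bigcup_closed => //;
    exact: discrete_family_locally_finite.
have AB0 : A `&` B = set0.
  by apply/seteqP; split => // x [nVx [i _ Ex]]; apply: nVx; exists i => //;
    exact: EV.
have /(@uniform_separatorP _ R)[h [hc h01 hA hB]] : uniform_separator A B.
  by apply: (iffLR (@normal_separatorP R T)) => //;
    exact: (collectionwise_normal_normal R).
have h0 x : 0 <= h x.
  by have /h01/= : range h (h x) by []; rewrite in_itv/= => /andP[].
have hA0 x : A x -> h x = 0 by move=> Ax; apply: hA; exists x.
have hB1 x : B x -> h x = 1 by move=> Bx; apply: hB; exists x.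
pose same x y := exists2 i, V i x & V i y.
have same_sym x y : same x y -> same y x by case=> i; exists i.
have same_trans y x z : same x y -> same y z -> same x z.
  by move=> [i Vx Vy] [j Vy' Vz]; exists i; rewrite // (Vdisj _ _ _ Vy Vy').
pose rho x y := if `[< same x y >] then `|h x - h y| else h x + h y.
exists rho; split; first split.
- move=> x; rewrite /rho; case: asboolP => [_|nVx].
    by rewrite subrr normr0.
  rewrite (hA0 x) ?addr0// => -[i _ Vx].
  by apply: nVx; exists i.
- move=> x y; rewrite /rho distrC (addrC (h x)).
  by congr (if _ then _ else _); apply/asboolP/asboolP; exact: same_sym.
- move=> y x z; rewrite /rho.
  have := h0 x; have := h0 y; have := h0 z => hz hy hx.
  have := ler_distD (h y) (h x) (h z).
  have := ler_norm (h x - h y); have := ler_norm (h y - h x).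
  have := ler_norm (h y - h z); have := ler_norm (h z - h y).
  have := ler_normB (h x) (h z); rewrite (ger0_norm hx) (ger0_norm hz).
  rewrite (distrC (h y) (h x)) (distrC (h z) (h y)).
  case: (asboolP (same x y)) => [xy|nxy];
    case: (asboolP (same y z)) => [yz|nyz];
    case: (asboolP (same x z)) => [xz|nxz]; try lra.
  by have := nxz (same_trans _ _ _ xy yz).
- move=> x e e0.
  have hx : \forall y \near x, `|h x - h y| < e.
    by have /cvgrPdist_lt := hc x; apply.
  have [[i _ Vx]|nVx] := pselect ((\bigcup_i V i) x).
    have : nbhs x (V i) by apply: open_nbhs_nbhs.
    apply: filterS2 hx => y hy Vy.
    by rewrite /rho; case: asboolP => // -[]; exists i.
  apply: filterS hx => y; rewrite /rho (hA0 x nVx) sub0r normrN add0r.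
  by rewrite (ger0_norm (h0 y)); case: ifP.
- move=> i x y Ex; rewrite /rho; case: asboolP => [[j Vx Vy] _|_].
    by rewrite (Vdisj i j x (EV _ _ Ex) Vx); case: Vy.
  by rewrite (hB1 x); [have := h0 y; lra|exists i].
Qed.

(** Write [S x] for the set of the indices of the members through [x].  The sets
    [E (m, k)] are closed, cover [T], and consist of points where [S] has
    exactly [m] elements.  Since [S y `<=` S x] for [y] near [x], every point
    [x] of [E (m, k)] shares its [S] with the nearby points of [E (m, k)].
    Hence the traces on [E (m, k)] of the level sets of [S], indexed by sets of
    indices, form a discrete closed family, and the trace for [s] can be
    expanded to the open set [U s] that the members outside [s] miss. *)
Lemma locally_finite_resolution (R : realType) (T : topologicalType)
    (J : choiceType) (K : J -> set T) :
  collectionwise_normal T -> perfect_space T ->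
  (forall i, closed (K i)) -> locally_finite K ->
  exists rho : nat * nat -> T -> T -> R,
    [/\ forall n, pseudometric (rho n), forall n, continuous_distance (rho n) &
        forall x, exists n, forall y i, rho n x y < 1 -> K i y -> K i x].
Proof.
move=> Tcwn Tperf Kcl Klf.
pose S x := [set i | K i x].
have Sfin x : finite_set (S x) by exact: locally_finite_index.
have Snear x : \forall y \near x, S y `<=` S x.
  by apply: filterS (locally_finite_near Kcl Klf x) => y yx i; exact: yx.
pose c x := #|` fset_set (S x)|.
have c_le x y : S y `<=` S x -> (c y <= c x)%N.
  by rewrite fset_set_sub//; exact: fsubset_leq_card.
have c_eq x y : S y `<=` S x -> (c x <= c y)%N -> S y = S x.
  move=> yx cxy; apply: fset_set_inj => //.
  by apply/eqP; rewrite eqEfcard cxy andbT -fset_set_sub.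
have c_usc m : open [set x | (c x <= m)%N].
  rewrite openE => x /= cx; apply: filterS (Snear x) => y /c_le cyx.
  exact: leq_trans cx.
have /choice[G Gm] m : exists G : nat -> set T,
    (forall k, open (G k)) /\ ~` [set x | (c x <= m)%N] = \bigcap_k G k.
  by have [G Go GE] := Tperf _ (open_closedC (c_usc m)); exists G.
pose E (n : nat * nat) := [set x | (n.1 <= c x)%N] `&` ~` G n.1 n.2.
have Ecl n : closed (E n).
  apply: closedI; last by apply: open_closedC; have [] := Gm n.1.
  rewrite -openC (_ : ~` _ = [set x | (c x < n.1)%N]); last first.
    by apply/predeqP => x /=; rewrite ltnNge; split=> /negP.
  case: n.1 => [|m]; last exact: c_usc.
  by rewrite (_ : [set _ | _] = set0); [exact: open0|apply/seteqP; split].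
have E_c n x : E n x -> c x = n.1.
  move=> [/= nc nG]; apply/eqP; rewrite eqn_leq nc andbT leqNgt.
  apply/negP => cn.
  have : (~` [set x | (c x <= n.1)%N]) x by apply/negP; rewrite -ltnNge.
  by rewrite (Gm n.1).2 => /(_ n.2 I).
have E_S n x : E n x -> \forall y \near x, E n y -> S y = S x.
  move=> Ex; apply: filterS (Snear x) => y yx Ey.
  by apply: c_eq => //; rewrite (E_c _ _ Ex) (E_c _ _ Ey).
pose F n (s : set J) := E n `&` [set x | S x = s].
have Fcl n s : closed (F n s).
  move=> x Fx; have Ex : E n x.
    by apply: Ecl; apply: closureS Fx => y [].
  have [y [[Ey <-] yx]] := Fx _ (E_S n x Ex).
  by split => //=; rewrite yx.
have Fd n : discrete_family (F n).
  move=> x; have [Ex|nEx] := pselect (E n x).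
    exists [set y | E n y -> S y = S x]; first exact: E_S.
    by move=> s t [y [[Ey <-] /= ->//]] [z [[Ez <-] /= ->//]].
  exists (~` E n); last by move=> s t [y [[]]].
  by apply: open_nbhs_nbhs; split => //; exact: closed_openC.
pose U (s : set J) := ~` \bigcup_(i in ~` s) K i.
have Uo s : open (U s).
  exact/closed_openC/locally_finite_bigcup_closed.
have FU n s : F n s `<=` U s by move=> x [_ <-] [i].
have /choice[rho rhoP] n :=
  discrete_family_separation R Tcwn (Fcl n) (Fd n) Uo (FU n).
exists rho; split=> [n|n|x]; try by have [] := rhoP n.
have : ~ (~` [set y | (c y <= c x)%N]) x by move/(_ (leqnn _)).
rewrite (Gm (c x)).2 => /existsNP[k /not_implyP[_ nGx]].
have Fx : F (c x, k) (S x) x by split => //; split => /=.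
exists (c x, k) => y i xy Kiy; have [_ _ FU_near] := rhoP (c x, k).
apply: contrapT => nKix; apply: (FU_near _ _ _ Fx xy).
by exists i.
Qed.

(** This is a weak form of the theorem of Stone that metric spaces are
    paracompact.  Assign to each point [z] the least [x], in a well-order of
    the space, with [d x z < eps].  The set [A n x] holds the points
    assigned to [x], up to margins of order [delta n] which ensure that, for a
    fixed [n], sets [A n x] with distinct [x] are at distance at least
    [delta n].  The interiors of their unions [W n] cover the space, and
    removing from [A n x] the interiors of the earlier [W m] leaves a closed
    cover which is locally finite: the interior of [W N] meets only the levels
    up to [N], and a ball of radius [delta N / 2] meets at most one set of each
    of these levels. *)
Lemma small_closed_cover (R : realType) (T : topologicalType)
    (d : T -> T -> R) (eps : R) :
  pseudometric d -> continuous_distance d -> 0 < eps ->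
  exists C : nat * T -> set T, [/\ forall i, closed (C i), locally_finite C,
    forall x, exists i, C i x &
    forall i x y, C i x -> C i y -> d x y <= eps *+ 2].
Proof.
move=> d_pm d_dom eps0; have [dxx dsym dtri] := d_pm.
have [le le_wo] := wochoice.well_ordering_principle T.
have le_asym x y : le x y -> le y x -> x = y.
  move=> xy yx; apply: (@wochoice.wo_chain_antisymmetric T le predT) => //.
    by move=> A _; exact: le_wo.
  by rewrite xy yx.
pose delta n : R := n.+1%:R^-1.
have delta0 n : 0 < delta n by rewrite invr_gt0 ltr0n.
have delta_le n m : (n <= m)%N -> delta m <= delta n.
  by move=> nm; rewrite lef_pV2 ?posrE ?ltr0n// ler_nat ltnS.
pose A n x := [set w | d x w <= eps - delta n *+ 2] `&`
  \bigcap_(z in [set z | ~~ le x z]) [set w | eps - delta n <= d z w].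
have d_cont x : continuous (d x).
  move=> y; apply/cvgrPdist_lt => e e0; apply: filterS (d_dom y e e0) => z yz.
  have := dtri z x y; have := dtri y x z; rewrite (dsym z y) => h1 h2.
  by rewrite ltr_distl; apply/andP; split; lra.
have Acl n x : closed (A n x).
  apply: closedI; last apply: closed_bigI => z _.
  - apply: (@preimage_closed _ _ (d x) [set r | r <= _]); last exact: closed_le.
    by move=> y _; exact: d_cont.
  - apply: (@preimage_closed _ _ (d z) [set r | _ <= r]); last exact: closed_ge.
    by move=> y _; exact: d_cont.
have A_near n x z : d x z < eps - delta n *+ 3 ->
    (forall x', ~~ le x x' -> eps <= d x' z) -> nbhs z (A n x).
  move=> xz xmin; apply: filterS (d_dom z _ (delta0 n)) => w zw; split => /=.
    by have := dtri z x w; lra.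
  by move=> x' /= /xmin ?; have := dtri w x' z; rewrite (dsym w z); lra.
have A_far n x x' w w' : A n x w -> A n x' w' -> ~~ le x x' ->
    delta n <= d w w'.
  move=> [/= _ Aw] [/= Aw' _] xx'; have /= := Aw x' xx'.
  by have := dtri w' x' w; rewrite (dsym w' w); lra.
pose W n := \bigcup_x A n x.
have cover z : exists n, (W n)° z.
  have [|x [[xz xmin] _]] := le_wo [pred x | d x z < eps].
    by exists z; rewrite inE dxx.
  have {}xz : d x z < eps by [].
  have e30 : 0 < (eps - d x z) / 3 by rewrite divr_gt0// subr_gt0.
  have [N _ /(_ _ (leqnn N)) NE] := near_infty_natSinv_lt (PosNum e30).
  exists N; apply: filterS (A_near N x z _ _).
  - by move=> w Aw; exists x.
  - by rewrite /= -/(delta N) in NE; lra.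
  - move=> x' xx'; rewrite leNgt; apply: contra xx' => x'z.
    exact: xmin.
pose C (i : nat * T) := A i.1 i.2 `\` \bigcup_(m < i.1) (W m)°.
exists C; split.
- move=> i; apply: closedI => //; apply: open_closedC.
  by apply: bigcup_open => m _; exact: open_interior.
- move=> z; have [N WN] := cover z.
  pose r := delta N / 2.
  have r0 : 0 < r by rewrite divr_gt0.
  exists ((W N)° `&` [set w | d z w < r]).
    by apply: filterI; [exact: nbhs_interior|exact: d_dom].
  set P := [set i | _].
  have PN i : P i -> (i.1 < N.+1)%N.
    move=> [w [[_ nWw] [WNw _]]]; rewrite ltnS leqNgt; apply/negP => Ni.
    by apply: nWw; exists N.
  have P_inj : {in P &, injective fst}.
    move=> [n x] [m x'] /set_mem Px /set_mem Px' /= nm; subst m.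
    have nN := PN _ Px.
    move: Px Px' => [w [[Aw _] [_ zw]]] [w' [[Aw' _] [_ zw']]].
    have ww' : d w w' < delta n.
      apply: (@lt_le_trans _ _ (delta N)); last exact: delta_le.
      by move: zw zw'; have := dtri z w w'; rewrite /r /= (dsym w z); lra.
    congr pair; apply: le_asym; move: ww'; rewrite ltNge;
      apply: contraNT => xx'.
      exact: (A_far n x x').
    by rewrite dsym; exact: (A_far n x' x).
  rewrite -(eq_finite_set (inj_card_eq P_inj)).
  apply: (@sub_finite_set _ _ `I_N.+1); last exact: finite_II.
  by move=> _ [i Pi <-]; exact: PN.
- move=> z; have [n0 Wn0] := cover z.
  have exW : exists n, `[< W n z >].
    by exists n0; apply/asboolP; exact: interior_subset.
  case: (ex_minnP exW) => n /asboolP[x _ Az] nmin.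
  exists (n, x); split => //= -[m /= mn Wm].
  by have := nmin m; rewrite leqNgt mn => /(_ (asboolT (interior_subset Wm))).
- move=> i x y [[/= Ax _] _] [[/= Ay _] _].
  have := dtri i.2 x y; rewrite (dsym x i.2); have := delta0 i.1; lra.
Qed.

(** * Perfect maps *)

(** A compact fibre has a neighbourhood [U] that meets only finitely many
    members, and as [f] is closed, the fibres over the points near [y] lie in
    [U]. *)
Lemma perfect_map_locally_finite (X Y : topologicalType) (f : X -> Y)
    (I : Type) (C : I -> set X) :
  perfect_map f -> locally_finite C -> locally_finite (fun i => f @` C i).
Proof.
case=> _ fclosed fcompact Clf y.
pose fin (U : set X) := finite_set [set i | C i `&` U !=set0].
have fin0 : fin set0.
  rewrite /fin (_ : [set _ | _] = set0); first exact: finite_set0.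
  by apply/seteqP; split => // i [x [_ []]].
suff [U finU fU] : exists2 U, fin U & f @^-1` [set y] `<=` U°.
  exists (~` (f @` (~` U°))).
    apply: open_nbhs_nbhs; split.
      apply/closed_openC/fclosed/open_closedC; exact: open_interior.
    by move=> [x nUx fxy]; apply: nUx; exact: fU.
  apply: sub_finite_set finU => i [_ [[x Cx <-] nfx]].
  exists x; split => //; apply: interior_subset; apply: contrapT => nUx.
  by apply: nfx; exists x.
(* Sets [U] of this kind are closed under finite unions, so if none were a
   neighbourhood of the fibre, what their interiors leave of the fibre would
   generate a proper filter, and a cluster point of it could not have a
   neighbourhood meeting finitely many members. *)
apply: contrapT => noU.
pose F := filter_from fin (fun U => f @^-1` [set y] `\` U°).
have F_proper : ProperFilter F.
  apply: filter_from_proper.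
    apply: filter_from_filter.
      by exists set0.
    move=> U V finU finV; exists (U `|` V).
      apply: (@sub_finite_set _ _ ([set i | C i `&` U !=set0] `|`
          [set i | C i `&` V !=set0])); last by rewrite finite_setU.
      by move=> i [x [Cx [Ux|Vx]]]; [left|right]; exists x.
    move=> x [xy nUV]; split; split => // Wx; apply: nUV;
      apply: (@filterS _ (nbhs x)) Wx => z Wz; [left|right]; exact: Wz.
  move=> U finU; apply: contrapT => KU; apply: noU; exists U => // x xy.
  by apply: contrapT => nUx; apply: KU; exists x.
have [|x [xy clx]] := fcompact y F F_proper.
  by exists set0 => // x [].
have [V Vx finV] := Clf x.
have FV : F (f @^-1` [set y] `\` V°) by exists V.
by have [z [[_ nVz] Vz]] := clx _ _ FV (nbhs_interior Vx).
Qed.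

(** Fibres stay compact in a coarser topology.  For closedness, let [y] be in
    the closure of the image of a closed set [C].  The last hypothesis gives
    points of the fibre over [y] arbitrarily close to [C]; by compactness they
    cluster at a point of the fibre, which then belongs to [C]. *)
Lemma perfect_map_distance (R : realType) (X Y : topologicalType) (f : X -> Y)
    (dX : X -> X -> R) (dY : Y -> Y -> R)
    (sX : Topological.axioms_ X) (sY : Topological.axioms_ Y) :
  perfect_map f -> coarser sX -> pseudometric dX -> pseudometric dY ->
  (forall x A, @nbhs _ (retopologize sX) x A <->
     exists2 e, 0 < e &
       forall x', Num.max (dX x x') (dY (f x) (f x')) < e -> A x') ->
  (forall y A, @nbhs _ (retopologize sY) y A <->
     exists2 e, 0 < e & forall y', dY y y' < e -> A y') ->
  (forall y e, 0 < e -> exists2 r, 0 < r & forall x', dY y (f x') < r ->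
     exists2 x, f x = y & dX x x' < e) ->
  @perfect_map (retopologize sX) (retopologize sY) f.
Proof.
move=> [_ _ fcompact] sXc [_ _ dXtri] [_ _ dYtri] sXE sYE fu.
have fcompact' y : @compact (retopologize sX) (f @^-1` [set y]).
  move=> F FF FK; have [x [xy clx]] := fcompact y F FF FK.
  exists x; split => // A B FA xB; apply: clx => //.
  move: xB; rewrite !nbhsE => -[U [oU Ux] UB]; exists U => //.
  by split => //; exact: sXc.
split => //.
  move=> x A /sYE[e e0 eA]; apply/sXE; exists e => // x'.
  by rewrite gt_max => /andP[_ /eA].
move=> C Ccl y fCy.
apply: contrapT => nCy.
pose F := filter_from [set e : R | 0 < e] (fun e =>
  f @^-1` [set y] `&` [set x | exists2 x', C x' &
     Num.max (dX x x') (dY (f x) (f x')) < e]).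
have F_proper : ProperFilter F.
  apply: filter_from_proper.
    apply: filter_from_filter; first by exists 1; rewrite /= ltr01.
    move=> e1 e2 /= e10 e20; exists (Num.min e1 e2).
      by rewrite /= lt_min e10.
    move=> x [xy [x' Cx']]; rewrite lt_min => /andP[h1 h2].
    by split; split => //; exists x'.
  move=> e /= e0; have [r r0 rP] := fu y e e0.
  have [|_ [[x' Cx' <-] /=]] := fCy [set y' | dY y y' < Num.min r e].
    by apply/sYE; exists (Num.min r e); rewrite // lt_min r0.
  rewrite lt_min => /andP[/rP[x xy xx'] yx'].
  by exists x; split => //; exists x'; rewrite // gt_max xx' xy.
have [|x [xy clx]] := fcompact' y F F_proper.
  by exists 1; [rewrite /= ltr01|move=> x []].
apply: nCy; exists x => //; apply: Ccl => A /sXE[e e0 eA].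
have e20 : 0 < e / 2 by rewrite divr_gt0.
pose B := [set x' | Num.max (dX x x') (dY (f x) (f x')) < e / 2].
have xB : @nbhs _ (retopologize sX) x B by apply/sXE; exists (e / 2).
have [z [[zy [x' Cx' zx']] zB]] :=
  clx _ _ (ex_intro2 _ _ (e / 2) e20 (@subset_refl _ _)) xB.
move: zx'; rewrite gt_max => /andP[h1 h2]; exists x'; split => //; apply: eA.
move: zB; rewrite /B /= gt_max => /andP[h3 h4]; rewrite gt_max.
have := dXtri z x x'; have := dYtri (f z) (f x) (f x') => h5 h6.
by apply/andP; split; lra.
Qed.

Theorem theorem7 (R : realType) (X Y : topologicalType) (f : X -> Y)
    (Ysub : submetrizable R Y) (Ycwn : collectionwise_normal Y)
    (Yperf : perfect_space Y) (Xsub : submetrizable R X)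
    (fperf : perfect_map f) :
  perfect_submetrizable R f.
Proof.
have [dX [dX_pm dX_sep dX_dom]] := submetrizable_distance Xsub.
have [dY [dY_pm dY_sep dY_dom]] := submetrizable_distance Ysub.
have [fcont fclosed fcompact] := fperf.
pose eps (n : nat) : R := n.+1%:R^-1.
have eps0 n : 0 < eps n by rewrite invr_gt0 ltr0n.
have /choice[C CP] n := small_closed_cover dX_pm dX_dom (eps0 n).
have /choice[rho rhoP] n : exists rho : nat * nat -> Y -> Y -> R,
    [/\ forall k, pseudometric (rho k), forall k, continuous_distance (rho k) &
        forall y, exists k, forall y' i, rho k y y' < 1 ->
          (f @` C n i) y' -> (f @` C n i) y].
  have [Ccl Clf _ _] := CP n.
  apply: locally_finite_resolution => //; first by move=> i; exact: fclosed.
  exact: perfect_map_locally_finite.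
pose sigma (j : option (nat * (nat * nat))) :=
  if j is Some (n, k) then rho n k else dY.
have [||D [D_pm D_dom D_sigma]] := @combine_pseudometrics R Y _ sigma.
- by move=> [[n k]|] //=; have [] := rhoP n.
- by move=> [[n k]|] //=; have [] := rhoP n.
(* [D] controls [dY], the pseudometric of index [None]. *)
have D_sep : separating D.
  move=> y y' Dyy'; apply: dY_sep; apply/eqP.
  rewrite eq_le (pseudometric_ge0 _ _ dY_pm) andbT.
  apply/ler_addgt0Pl => e e0; rewrite addr0.
  by have [r r0 rP] := D_sigma None e e0; apply/ltW/rP; rewrite Dyy'.
pose DX x x' := Num.max (dX x x') (D (f x) (f x')).
have DX_pm : pseudometric DX.
  have [dXxx dXsym dXtri] := dX_pm; have [Dxx Dsym Dtri] := D_pm.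
  split.
  - by move=> x; rewrite /DX dXxx Dxx maxxx.
  - by move=> x x'; rewrite /DX dXsym Dsym.
  - move=> y x z; rewrite /DX ge_max; apply/andP; split.
    + by apply: (le_trans (dXtri y x z)); rewrite lerD// le_max lexx.
    + by apply: (le_trans (Dtri (f y) _ _)); rewrite lerD// le_max lexx orbT.
have DX_sep : separating DX.
  move=> x x' DX0; apply: dX_sep; apply/eqP.
  by rewrite eq_le (pseudometric_ge0 _ _ dX_pm) andbT -DX0 le_max lexx.
have DX_dom : continuous_distance DX.
  move=> x e e0; have fD := fcont x _ (D_dom (f x) e e0).
  by apply: filterS2 (dX_dom x e e0) fD => x' xx' fxx'; rewrite gt_max xx'.
have [sX [mX sXE]] := distance_topology DX_pm DX_sep.
have [sY [mY sYE]] := distance_topology D_pm D_sep.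
have sX_coarser : coarser sX.
  by apply: (continuous_distance_coarser DX_dom) => x A /sXE.
have sY_coarser : coarser sY.
  by apply: (continuous_distance_coarser D_dom) => x A /sYE.
exists sX, sY; split => //.
apply: (perfect_map_distance (dX := dX) (dY := D) fperf) => // y e e0.
have e20 : 0 < e / 2 by rewrite divr_gt0.
have [n _ /(_ _ (leqnn n)) ne] := near_infty_natSinv_lt (PosNum e20).
have [_ _ Ccov Csmall] := CP n; have [_ _ /(_ y)[k ky]] := rhoP n.
have [r r0 rP] := D_sigma (Some (n, k)) 1 ltr01; exists r => // x' /rP/ky yx'.
have [i Cx'] := Ccov x'.
have [|x Cx xy] := yx' i; first by exists x'.
exists x => //; apply: le_lt_trans (Csmall i x x' Cx Cx') _.
by rewrite /= -/(eps n) in ne; lra.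
Qed.
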